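(* Let $n\ge0$ be an integer, $\sigma>0$, $\delta\in(0,1)$, $r\ge1$, $C_0>0$. Let $x\in\mathbb{C}(\mathbb{Z})$ and $y_\tau=x_\tau+\sigma\zeta_\tau$, $-n\le\tau\le n$, with $\zeta_\tau$ i.i.d. standard complex Gaussian. Assume there is a deterministic (oracle) filter $\varphi^o\in\mathbb{C}_n(\mathbb{Z})$ with $\|F_n[\varphi^o]\|_1\le \frac{r}{\sqrt{n+1}}$ such that for every $0\le\tau\le n$ and every $\delta'\in(0,1)$, with probability at least $1-\delta'$, $$|x_\tau-[\varphi^o*y]_\tau|\le\frac{3\sigma r\sqrt{1+\log\left(\frac{n+1}{\delta'}\right)}}{\sqrt{n+1}}.$$ Let $\tilde\varphi$ be an $\varepsilon_*$-accurate solution, with $\varepsilon_*\le C_0\sigma r$, either to the problem (Con-UF) $$\min\left\{\|F_n[y-\varphi*y]\|_\infty:\ \varphi\in\mathbb{C}_n(\mathbb{Z}),\ \|F_n[\varphi]\|_1\le\tfrac{r}{\sqrt{n+1}}\right\},$$ or to the problem (Pen-UF) $$\min_{\varphi\in\mathbb{C}_n(\mathbb{Z})}\ \|F_n[y-\varphi*y]\|_\infty+\lambda\|F_n[\varphi]\|_1,\qquad \lambda=16\sigma\sqrt{(n+1)\left(1+\log\left(\tfrac{n+1}{\delta}\right)\right)}.$$ Then with probability at least $1-\delta$, $$|x_n-[\tilde\varphi*y]_n|\le\frac{C\sigma r^2\sqrt{1+\log\left(\frac{n+1}{\delta}\right)}}{\sqrt{n+1}},$$ where $C$ is a constant depending only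 on $C_0$.
   Context: $\mathbb{C}(\mathbb{Z})$ is the space of two-sided complex sequences; $\mathbb{C}_n(\mathbb{Z})$ is the subspace of sequences supported on $[0,n]$. A standard complex Gaussian variable has independent standard real Gaussian real and imaginary parts. $[\varphi*y]_t=\sum_{\tau}\varphi_\tau y_{t-\tau}$; for $\varphi\in\mathbb{C}_n(\mathbb{Z})$ and $0\le t\le n$ it only involves $y_{-n},\dots,y_n$. $F_n$ is the unitary DFT on $\mathbb{C}^{n+1}$, $[F_nx]_k=\frac1{\sqrt{n+1}}\sum_{t=0}^nx_te^{2\pi ikt/(n+1)}$; for a signal $x$, $F_n[x]$ denotes $F_n$ applied to $(x_0,\dots,x_n)$. $\|\cdot\|_p$ is the $\ell_p$-norm on $\mathbb{C}^{n+1}$. An $\varepsilon_*$-accurate solution of a minimization problem is a feasible point (possibly depending on $y$) whose objective value exceeds the optimal value by at most $\varepsilon_*$. $\log$ is the natural logarithm. *)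

(* Defs.v *)
From HB Require Import structures.
From mathcomp Require Import all_boot all_order all_algebra finmap.
From mathcomp Require Export all_classical all_reals all_analysis.
From mathcomp Require Export complex.

Set Implicit Arguments.
Unset Strict Implicit.
Unset Printing Implicit Defensive.

Import Order.TTheory GRing.Theory Num.Theory.
Import numFieldNormedType.Exports.
Import Normc.

Local Open Scope classical_set_scope.
Local Open Scope ring_scope.
Local Open Scope complex_scope.

Definition signal (R : realType) : Type := int -> R[i].

Definition supported (R : realType) (n : nat) (phi : signal R) : Prop :=
  forall t : int, ~~ (0 <= t <= n%:Z) -> phi t = 0.

(* The sum over all of Z is a finite-support sum; it is only meant for filters
   phi with finite support (for an infinitely supported summand the library
   operator returns 0). *)
Definition convolution (R : realType) (phi y : signal R) : signal R :=
  fun t => \sum_(tau \in [set: int]) phi tau * y (t - tau).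

Definition cis (R : realType) (a : R) : R[i] := cos a +i* sin a.

Definition restrict_signal (R : realType) (n : nat) (x : signal R)
    : 'cV[R[i]]_n.+1 :=
  \col_(t < n.+1) x t%:Z.

Definition dft (R : realType) (n : nat) (v : 'cV[R[i]]_n.+1)
    : 'cV[R[i]]_n.+1 :=
  \col_(k < n.+1) ((Num.sqrt n.+1%:R)^-1%:C *
     \sum_(t < n.+1) v t 0 * cis (2 * pi * k%:R * t%:R / n.+1%:R)).

(* F_n[x] for a signal x. *)
Definition dft_signal (R : realType) (n : nat) (x : signal R)
    : 'cV[R[i]]_n.+1 :=
  dft (restrict_signal n x).

(* [normc] is the real-valued complex modulus. *)
Definition norm_l1 (R : realType) (n : nat) (v : 'cV[R[i]]_n.+1) : R :=
  \sum_(k < n.+1) normc (v k 0).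

Definition norm_loo (R : realType) (n : nat) (v : 'cV[R[i]]_n.+1) : R :=
  \big[Num.max/0]_(k < n.+1) normc (v k 0).

Definition accurate_solution (R : realType) (X : Type)
    (feasible : set X) (objective : X -> R) (eps : R) (u : X) : Prop :=
  feasible u /\ objective u <= inf (objective @` feasible) + eps.

Definition residual (R : realType) (n : nat) (y phi : signal R) : R :=
  norm_loo (dft_signal n (y \- convolution phi y)).

Definition con_uf_solution (R : realType) (n : nat) (r : R) (y : signal R)
    (eps : R) (phi : signal R) : Prop :=
  accurate_solution
    [set psi | supported n psi /\
               norm_l1 (dft_signal n psi) <= r / Num.sqrt n.+1%:R]
    (residual n y) eps phi.

Definition pen_uf_solution (R : realType) (n : nat) (lambda : R)
    (y : signal R) (eps : R) (phi : signal R) : Prop :=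
  accurate_solution
    [set psi | supported n psi]
    (fun psi => residual n y psi + lambda * norm_l1 (dft_signal n psi))
    eps phi.

(* The event E need not be measurable (E may involve an arbitrary, possibly
   non-measurable, choice of a solution): it has to contain a measurable event
   of probability at least p.  For measurable E this is p <= P(E). *)
Definition with_probability_at_least (R : realType) (d : measure_display)
    (T : measurableType d) (P : probability T R) (p : R) (E : set T) : Prop :=
  exists A : set T, [/\ measurable A, A `<=` E & (p%:E <= P A)%E].

Definition standard_gaussian (R : realType) (d : measure_display)
    (T : measurableType d) (P : probability T R) (X : T -> R) : Prop :=
  measurable_fun [set: T] X /\
  forall B : set R, measurable B -> P (X @^-1` B) = normal_prob 0 1 B.

Definition standard_complex_gaussian (R : realType) (d : measure_display)
    (T : measurableType d) (P : probability T R) (Z : T -> R[i]) : Prop :=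
  let X w := complex.Re (Z w) in
  let Y w := complex.Im (Z w) in
  [/\ standard_gaussian P X, standard_gaussian P Y &
      forall A B : set R, measurable A -> measurable B ->
        P (X @^-1` A `&` Y @^-1` B) = (P (X @^-1` A) * P (Y @^-1` B))%E].

(* Mutual independence of (X i) for i in D: the product rule for every finite
   subfamily. *)
Definition mutually_independent (R : realType) (d d' : measure_display)
    (T : measurableType d) (S : measurableType d') (P : probability T R)
    (I : choiceType) (D : set I) (X : I -> T -> S) : Prop :=
  forall (J : {fset I}) (B : I -> set S),
    [set` J] `<=` D ->
    (forall i, i \in J -> measurable (B i)) ->
    P (\bigcap_(i in [set` J]) (X i @^-1` B i)) =
    (\prod_(i <- J) P (X i @^-1` B i))%E.

(* R[i] carries no sigma-algebra in the library; complex random variables are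
   seen in R * R with the product (Borel) sigma-algebra. *)
Definition real_pair (R : realType) (z : R[i])
    : measurableTypeR R * measurableTypeR R :=
  (complex.Re z, complex.Im z).

Definition iid_standard_complex_gaussian (R : realType) (d : measure_display)
    (T : measurableType d) (P : probability T R) (D : set int)
    (zeta : int -> T -> R[i]) : Prop :=
  mutually_independent P D (fun tau w => real_pair (zeta tau w)) /\
  forall tau, D tau -> standard_complex_gaussian P (zeta tau).

(* The values of zeta outside [-n, n] are left unconstrained wherever this is
   used; they do not enter [phi * y]_t for 0 <= t <= n and phi supported on
   [0, n]. *)
Definition observation (R : realType) (T : Type) (sigma : R) (x : signal R)
    (zeta : int -> T -> R[i]) (w : T) : signal R :=
  fun tau => x tau + sigma%:C * zeta tau w.

(* Main.v *)
(* Idea.  Write N = n + 1, L = sqrt (1 + ln (N / delta)), z for the noise and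
   |.|_1 for the l1-norm of the DFT.  With probability 1 - delta / 2 all DFTs of
   the N windows of the noise are at most 8 L in modulus: their real and
   imaginary parts are sums of independent Gaussians of total variance 1, so
   Chernoff's bound and a union over N^2 entries apply.  The oracle bound at the
   N points, each with delta' = delta / (2 N), costs the other delta / 2.

   On this event everything is deterministic.  Commuting filters,
     x - ft * x = (1 - ft) * (x - fo * x) + fo * (x - ft * x)
   where fo is the oracle and ft the solution.  The first term is pointwise
   small, as the l1-norm of ft in time is at most sqrt N |ft|_1.  By inversion
   of the DFT the second one is at most |fo|_1 times the sup of the DFT of
   x - ft * x, which is the residual of ft up to the windowed noise; and ft has a
   residual comparable to that of fo by optimality.  For the penalized problem
   optimality also yields lambda |ft|_1 = O (sigma r L), so that |ft|_1 is
   O (r / sqrt N) by the size of lambda. *)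
From HB Require Import structures.
Require Import Defs.
From mathcomp Require Import all_boot all_order all_algebra finmap.
From mathcomp Require Import all_classical all_reals all_analysis complex.
From mathcomp Require Import measurable_realfun zify ring lra.

Set Implicit Arguments.
Unset Strict Implicit.
Unset Printing Implicit Defensive.

Import Order.TTheory GRing.Theory Num.Theory.
Import numFieldNormedType.Exports.
Import Normc.

Local Open Scope classical_set_scope.
Local Open Scope ring_scope.
Local Open Scope complex_scope.

(** * Integrals of functions of independent variables *)

Section DensityTransfer.
Local Open Scope ereal_scope.
Import HBNNSimple.
Context d1 d2 (T : measurableType d1) (S : measurableType d2) (R : realType).
Variables (m : {measure set T -> \bar R}) (nu : {measure set S -> \bar R}).
Variables (G : T -> R) (X : T -> S).
Hypotheses (G0 : forall x, (0 <= G x)%R) (mG : measurable_fun [set: T] G).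
Hypothesis mX : measurable_fun [set: T] X.
Hypothesis nuE : forall B, measurable B ->
  \int[m]_(x in X @^-1` B) (G x)%:E = nu B.

Let mXV B : measurable B -> measurable (X @^-1` B).
Proof. by move=> mB; rewrite -[X @^-1` B]setTI; exact: mX. Qed.

Let transfer_nnsfun (h : {nnsfun S >-> R}) :
  \int[m]_x ((h (X x))%:E * (G x)%:E) = \int[nu]_y (h y)%:E.
Proof.
have mGE : measurable_fun [set: T] (fun x => (G x)%:E) by exact/measurable_EFinP.
have mi r : measurable_fun [set: T] (\1_(X @^-1` (h @^-1` [set r])) : T -> R).
  by apply: measurable_indic; apply: mXV.
under [RHS]eq_integral do rewrite fimfunE -fsumEFin//.
rewrite [RHS]ge0_integral_fsum//; last 2 first.
  - by move=> r; exact/measurable_EFinP/measurableT_comp.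
  - by move=> n x _; rewrite EFinM nnfun_muleindic_ge0.
transitivity (\int[m]_x (\sum_(y \in range h)
    (y * \1_(X @^-1` (h @^-1` [set y])) x)%:E * (G x)%:E)).
  apply: eq_integral => x _.
  rewrite -[RHS]ge0_mule_fsuml; last first.
    by move=> y; exact: (@nnfun_muleindic_ge0 _ _ _ h).
  by rewrite fsumEFin// fimfunE.
have ge0 n x : 0 <= (n * \1_(X @^-1` (h @^-1` [set n])) x)%:E * (G x)%:E.
  by apply: mule_ge0; rewrite ?lee_fin//; exact: (@nnfun_muleindic_ge0 _ _ _ h).
rewrite [LHS]ge0_integral_fsum//; last first.
  move=> r; apply: emeasurable_funM => //; apply/measurable_EFinP.
  by apply: measurable_funM => //; exact: mi.
apply: eq_fsbigr => r rh.
rewrite integralZl_indic_nnsfun// integral_indic// setIT -nuE//.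
have r0 : (0 <= r)%R by move: rh; rewrite inE => -[t _ <-].
under eq_integral do rewrite EFinM -muleA.
rewrite ge0_integralZl//; last 2 first.
  - by apply: emeasurable_funM => //; apply/measurable_EFinP; exact: mi.
  - by move=> x _; rewrite mule_ge0 ?lee_fin.
congr (_ * _); rewrite [RHS]integral_mkcond; apply: eq_integral => x _.
by rewrite muleC epatch_indic.
Qed.

(** [nuE] says that [nu] is the image under [X] of the measure with density [G]. This covers a law
    ([G] = 1), a density ([X] = [id]) and a weighted law at once. Simple functions come first, then
    monotone convergence. *)
Lemma ge0_integral_density_transfer (f : S -> R) :
  (forall y, (0 <= f y)%R) -> measurable_fun [set: S] f ->
  \int[m]_x (f (X x) * G x)%:E = \int[nu]_y (f y)%:E.
Proof.
move=> f0 mf.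
have mfE : measurable_fun [set: S] (fun y => (f y)%:E).
  exact/measurable_EFinP.
pose h := nnsfun_approx measurableT mfE.
have hf x : (h n x)%:E @[n --> \oo] --> (f x)%:E.
  by apply: (@cvg_nnsfun_approx _ _ _ _ measurableT _ mfE) => // y _; rewrite lee_fin.
transitivity (limn (fun n => \int[m]_x ((h n (X x))%:E * (G x)%:E))).
  rewrite -monotone_convergence//=.
  - apply: eq_integral => x _; apply/esym/cvg_lim => //; rewrite EFinM.
    by apply: cvgeZr => //; exact: hf.
  - move=> n; apply: emeasurable_funM; last exact/measurable_EFinP.
    by apply/measurable_EFinP; apply: measurableT_comp.
  - by move=> n x _; rewrite mule_ge0 ?lee_fin.
  - move=> x _ a b ab; apply: lee_wpmul2r; rewrite lee_fin//.
    exact/lefP/nd_nnsfun_approx.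
transitivity (limn (fun n => \int[nu]_y (h n y)%:E)).
  by congr (limn _); apply/funext => n; exact: transfer_nnsfun.
rewrite -monotone_convergence//=.
- by apply: eq_integral => x _; apply/cvg_lim => //; exact: hf.
- by move=> n; apply/measurable_EFinP.
- by move=> n x _; rewrite lee_fin.
- by move=> y _ a b ab; rewrite lee_fin; exact/lefP/nd_nnsfun_approx.
Qed.

End DensityTransfer.

Section IndependentProduct.
Local Open Scope ereal_scope.
Context d (T : measurableType d) (R : realType) (P : probability T R).
Context d' (S : measurableType d') (I : finType).
Variables (X : I -> {mfun T >-> S}) (f : I -> S -> R) (M : I -> R).
Hypotheses (f0 : forall i y, (0 <= f i y)%R)
  (mf : forall i, measurable_fun [set: S] (f i)).
Hypothesis fM : forall i, \int[P]_w (f i (X i w))%:E = (M i)%:E.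
Hypothesis indepX : forall B : I -> set S, (forall i, measurable (B i)) ->
  P (\bigcap_i (X i @^-1` B i)) = \prod_i P (X i @^-1` B i).

Let M0 i : (0 <= M i)%R.
Proof. by rewrite -lee_fin -fM; apply: integral_ge0 => w _; rewrite lee_fin. Qed.

Let mXV i B : measurable B -> measurable (X i @^-1` B).
Proof. by move=> mB; rewrite -[_ @^-1` _]setTI; exact: measurable_funP. Qed.

Let mcap (s : seq I) (B : I -> set S) : (forall i, measurable (B i)) ->
  measurable (\bigcap_(i in [set` s]) (X i @^-1` B i)).
Proof.
move=> mB; apply: fin_bigcap_measurable => //= i _; exact: mXV.
Qed.

(* Induction on the number of coordinates whose event has been replaced by a
   function: [s1] carries the functions, [s2] the events. *)
Let integral_prod_indep_in (s1 s2 : seq I) (B : I -> set S) :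
  perm_eq (s1 ++ s2) (enum I) -> (forall i, measurable (B i)) ->
  \int[P]_(w in \bigcap_(i in [set` s2]) (X i @^-1` B i))
    (\prod_(i <- s1) f i (X i w))%:E =
  (\prod_(i <- s1) M i)%:E * \prod_(i <- s2) P (X i @^-1` B i).
Proof.
elim: s1 s2 B => [|i s1 IH] s2 B us mB.
  under eq_integral do rewrite big_nil.
  rewrite big_nil mul1e integral_cst ?mul1e; last exact: mcap.
  rewrite (perm_big _ us) /= big_enum -indepX//; congr (P _).
  apply/seteqP; split => w /= Xw i // _; apply: Xw => //=.
  by rewrite (perm_mem us) mem_enum.
have us' : perm_eq (s1 ++ i :: s2) (enum I).
  by rewrite -(permPl (permEl (perm_catCA [:: i] s1 s2))).
have is2 : i \notin s2.
  have := perm_uniq us; rewrite enum_uniq /= mem_cat negb_or.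
  by move=> /andP[/andP[_]].
have mG : measurable_fun [set: T] (fun w => \prod_(j <- s1) f j (X j w))%R.
  by apply: measurable_prod => j _; exact: measurableT_comp.
pose E := \bigcap_(j in [set` s2]) (X j @^-1` B j).
have mE : measurable E by exact: mcap.
have p0 : (0 <= fine (\prod_(j <- s2) P (X j @^-1` B j)))%R.
  by apply: fine_ge0; apply: prode_ge0.
have pfin : \prod_(j <- s2) P (X j @^-1` B j) \is a fin_num.
  by apply: prode_fin_num => j _; apply: fin_num_measure; exact: mXV.
have c0 : (0 <= (\prod_(j <- s1) M j) * fine (\prod_(j <- s2) P (X j @^-1` B j)))%R.
  by apply: mulr_ge0 => //; apply: prodr_ge0.
(* The other factors and the event form a weight [G]. By the induction hypothesis, the image under
   [X i] of [P] weighted by [G] is a constant multiple of the law of [X i], so integrating [f i]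
   contributes the factor [M i]. *)
pose G w := ((\prod_(j <- s1) f j (X j w)) * \1_E w)%R.
have Gge0 w : (0 <= G w)%R by rewrite mulr_ge0 ?prodr_ge0.
have mG' : measurable_fun [set: T] G.
  by apply: measurable_funM => //; exact: measurable_indic.
have patchE (g : T -> R) D : \int[P]_(w in D `&` E) (g w)%:E =
    \int[P]_(w in D) (g w * \1_E w)%:E.
  by rewrite integral_mkcondr epatch_indic; apply: eq_integral => w _; rewrite EFinM.
have GE C : measurable C -> \int[P]_(w in X i @^-1` C) (G w)%:E =
    mscale (NngNum c0) (distribution P (X i)) C.
  move=> mC; rewrite -patchE.
  (* The index [i] moves from the functions to the events, with event [C]; the events on [s2] do not
     change since [i] is not in it. *)
  pose B' j := if j == i then C else B j.
  have -> : X i @^-1` C `&` E = \bigcap_(j in [set` i :: s2]) (X j @^-1` B' j).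
    apply/seteqP; split => w /=.
      move=> [Cw Ew] j /=; rewrite inE /B'; case: eqP => [-> //|_ /= js].
      exact: Ew.
    move=> H; split; first by have := H i; rewrite /= /B' eqxx mem_head; exact.
    move=> j /= js; have := H j; rewrite /= /B' inE js orbT => /(_ isT).
    by case: eqP => // ji; move: is2; rewrite -ji js.
  rewrite IH//; last by move=> j; rewrite /B'; case: ifP.
  rewrite big_cons {1}/B' eqxx /mscale /= EFinM fineK// [in RHS]muleAC -!muleA.
  congr (_ * (_ * _)); apply: eq_big_seq => j js; rewrite /B'; case: eqP => // ji.
  by move: is2; rewrite -ji js.
transitivity (\int[P]_w (f i (X i w) * G w)%:E).
  rewrite -/E -[E]setTI patchE; apply: eq_integral => w _.
  by rewrite big_cons /G mulrA.
rewrite (ge0_integral_density_transfer Gge0 mG' (measurable_funPT (X i)) GE)//.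
rewrite ge0_integral_mscale//; last 2 first.
  - exact/measurable_EFinP.
  - by move=> y _; rewrite lee_fin.
rewrite ge0_integral_distribution//=; last 2 first.
  - exact/measurable_EFinP.
  - by move=> y; rewrite lee_fin.
by rewrite fM big_cons !EFinM fineK// muleC muleA.
Qed.

Lemma integral_prod_indep :
  \int[P]_w (\prod_i f i (X i w))%:E = (\prod_i M i)%:E.
Proof.
have := @integral_prod_indep_in (enum I) [::] (fun=> setT).
rewrite cats0 perm_refl set_nil bigcap_set0 big_nil mule1 big_enum => <- //.
by apply: eq_integral => w _; rewrite big_enum.
Qed.

End IndependentProduct.

(** * Gaussian moment generating function *)

Section GaussianMGF.
Context (R : realType) d (T : measurableType d) (P : probability T R).

(** Completing the square: an exponential tilt shifts the mean of the Gaussian density from 0 to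
    [s]. *)
Lemma expR_mul_normal_pdf (s x : R) :
  expR (s * x) * normal_pdf 0 1 x = expR (s ^+ 2 / 2) * normal_pdf s 1 x.
Proof.
rewrite !normal_pdfE ?oner_eq0// mulrCA [RHS]mulrCA /normal_fun -!expRD.
by congr (_ * expR _); rewrite expr1n; field.
Qed.

Lemma standard_gaussian_mgf (X : T -> R) (s : R) : standard_gaussian P X ->
  (\int[P]_w (expR (s * X w))%:E = (expR (s ^+ 2 / 2))%:E)%E.
Proof.
move=> [mX lawX].
have me : measurable_fun [set: R] (fun y : R => expR (s * y)).
  by apply: measurableT_comp => //; exact: measurable_funM.
have XE B : measurable B ->
    (\int[P]_(x in X @^-1` B) (cst 1%R x)%:E = normal_prob 0 1 B)%E.
  move=> mB; rewrite (_ : (fun x => (cst 1%R x)%:E) = cst 1%E)//.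
  rewrite integral_cst ?mul1e; first exact: lawX.
  by rewrite -[_ @^-1` _]setTI; exact: mX.
have e0 y : 0 <= expR (s * y) by exact: expR_ge0.
have := @ge0_integral_density_transfer _ _ _ _ R P (normal_prob 0 1) (cst 1) X
  (fun=> ler01) (measurable_cst _) mX XE _ e0 me.
under eq_integral do rewrite mulr1; move=> ->.
(* A second transfer, from the normal law to its density against Lebesgue measure; after the tilt
   only the total mass of a normal law is left. *)
rewrite -(ge0_integral_density_transfer (m := lebesgue_measure) (X := id)
  (G := normal_pdf 0 1))//; last 2 first.
  - exact: normal_pdf_ge0.
  - exact: measurable_normal_pdf.
under eq_integral do rewrite expR_mul_normal_pdf EFinM.
rewrite ge0_integralZl//; last 2 first.
  - by apply/measurable_EFinP; exact: measurable_normal_pdf.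
  - by move=> x _; rewrite lee_fin normal_pdf_ge0.
by rewrite integral_normal_pdf mule1.
Qed.

End GaussianMGF.

(** * Tails of Gaussian sums *)

Section GaussianTail.
Context (R : realType) d (T : measurableType d) (P : probability T R).

(** Chernoff's bound with parameter [a], the optimal one for variance 1: by independence the moment
    generating function is at most exp (a^2 / 2), and the bound multiplies it by exp (- a^2). *)
Lemma gaussian_sum_tail (I : finType) (X : I -> T -> R) (b : I -> R) (a : R) :
  (forall i, standard_gaussian P (X i)) ->
  (forall B : I -> set R, (forall i, measurable (B i)) ->
    P (\bigcap_i (X i @^-1` B i)) = (\prod_i P (X i @^-1` B i))%E) ->
  \sum_i b i ^+ 2 <= 1 -> 0 < a ->
  (P [set w | (a <= \sum_i b i * X i w)%R] <= (expR (- (a ^+ 2 / 2)))%:E)%E.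
Proof.
move=> gX indepX b1 a0.
have mX i : measurable_fun [set: T] (X i) by case: (gX i).
pose X' i : {mfun T >-> R} := HB.pack (X i) (isMeasurableFun.Build _ _ _ _ _ (mX i)).
have mY : measurable_fun [set: T] (fun w => \sum_i b i * X i w).
  by apply: measurable_sum => i; exact: measurable_funM.
pose Y : {RV P >-> R} :=
  HB.pack (fun w => \sum_i b i * X i w) (isMeasurableFun.Build _ _ _ _ _ mY).
apply: le_trans (chernoff Y a a0) _.
rewrite /mmt_gen_fun unlock.
have -> : (\int[P]_w ((expR \o a \o* Y) w)%:E =
    \int[P]_w (\prod_i expR (a * b i * X' i w))%:E)%E.
  apply: eq_integral => w _ /=; rewrite -expR_sum mulr_suml.
  by congr ((expR _)%:E); apply: eq_bigr => i _; ring.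
rewrite (integral_prod_indep (f := fun i y => expR (a * b i * y))
   (M := fun i => expR ((a * b i) ^+ 2 / 2)))//; last 2 first.
- by move=> i; apply: measurableT_comp => //; exact: measurable_funM.
- by move=> i; exact: (standard_gaussian_mgf _ (gX i)).
rewrite -EFinM lee_fin -expR_sum -expRD ler_expR -mulr_suml.
under eq_bigr do rewrite exprMn.
rewrite -mulr_sumr; have : a ^+ 2 * \sum_i b i ^+ 2 <= a ^+ 2 * 1.
  by apply: ler_wpM2l => //; exact: sqr_ge0.
by lra.
Qed.

End GaussianTail.

Section ComplexModulus.
Context (R : realType).
Implicit Types z : R[i].

Lemma normc_ge0 z : 0 <= normc z.
Proof. by case: z => a b; exact: sqrtr_ge0. Qed.

Lemma sqr_normcE z : normc z ^+ 2 = complex.Re z ^+ 2 + complex.Im z ^+ 2.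
Proof. by case: z => a b /=; rewrite sqr_sqrtr// addr_ge0// sqr_ge0. Qed.

Lemma normc_real (a : R) : normc a%:C = `|a|.
Proof. by rewrite /normc /= expr0n /= addr0 sqrtr_sqr. Qed.

Lemma le_normc_ReIm z : normc z <= `|complex.Re z| + `|complex.Im z|.
Proof.
rewrite -(@ler_pXn2r _ 2)// ?nnegrE ?addr_ge0 ?normc_ge0//.
rewrite sqr_normcE sqrrD !real_normK ?num_real// addrAC lerDl.
by rewrite mulrn_wge0// mulr_ge0.
Qed.

Lemma le_normc_sum (I : Type) (s : seq I) (p : pred I) (F : I -> R[i]) :
  normc (\sum_(i <- s | p i) F i) <= \sum_(i <- s | p i) normc (F i).
Proof.
elim/big_ind2: _ => //; first by rewrite normc0.
by move=> a b c e ab ce; apply: le_trans (le_normcD _ _) _; exact: lerD.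
Qed.

Lemma Re_sum (I : Type) (s : seq I) (p : pred I) (F : I -> R[i]) :
  complex.Re (\sum_(i <- s | p i) F i) = \sum_(i <- s | p i) complex.Re (F i).
Proof. by apply: (big_morph (@complex.Re R) _ (erefl _)) => -[a b] [c e]. Qed.

End ComplexModulus.

Lemma le_measure_bigsetU d (T : measurableType d) (R : realType)
    (mu : {measure set T -> \bar R}) (I : finType) (A : I -> set T) :
  (forall i, measurable (A i)) ->
  (mu (\big[setU/set0]_i A i) <= \sum_i mu (A i))%E.
Proof.
move=> mA; suff [] : measurable (\big[setU/set0]_i A i) /\
  (mu (\big[setU/set0]_i A i) <= \sum_i mu (A i))%E by [].
elim/big_rec2: _ => [|i m B _ [mB leB]]; first by rewrite measure0.
split; first exact: measurableU.
by apply: le_trans (measureU2 _ _ _) _ => //; exact: leeD2l.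
Qed.

Section ComplexGaussianTail.
Context (R : realType) d (T : measurableType d) (P : probability T R).
Variables (D : set int) (zeta : int -> T -> R[i]).
Hypothesis iid : iid_standard_complex_gaussian P D zeta.
Variables (J : finType) (g : J -> int).
Hypotheses (g_inj : injective g) (gD : forall j, D (g j)).

(** One real family indexed by [J * bool], so that a complex combination of the noise becomes a real
    sum within reach of [gaussian_sum_tail]. *)
Let part (jb : J * bool) (w : T) : R :=
  if jb.2 then complex.Re (zeta (g jb.1) w) else complex.Im (zeta (g jb.1) w).

Let part_gaussian jb : standard_gaussian P (part jb).
Proof. by case: jb => j []; case: (iid.2 _ (gD j)). Qed.

(** Independence at two levels: between distinct [g j], tested on rectangles, and then between the
    real and imaginary parts at the same [g j]. *)
Let part_indep (B : J * bool -> set R) : (forall jb, measurable (B jb)) ->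
  P (\bigcap_jb (part jb @^-1` B jb)) = (\prod_jb P (part jb @^-1` B jb))%E.
Proof.
move=> mB.
(* Mutual independence wants events indexed by integers; [pick] inverts the injective [g]. *)
pose C (i : int) : set (measurableTypeR R * measurableTypeR R) :=
  if [pick j | g j == i] is Some j then B (j, true) `*` B (j, false) else setT.
have Cg j : C (g j) = B (j, true) `*` B (j, false).
  rewrite /C; case: pickP => [k /eqP/g_inj -> //|/(_ j)]; by rewrite eqxx.
have := (proj1 iid) [fset g j | j in J]%fset C; rewrite big_imfset /=; last first.
  by move=> i j _ _; exact: g_inj.
have -> : \bigcap_(i in [set` [fset g j | j in J]%fset])
    ((fun w => real_pair (zeta i w)) @^-1` C i) =
    \bigcap_jb (part jb @^-1` B jb).
  apply/seteqP; split => w /= H.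
    move=> [j b] _; have := H (g j); rewrite /= in_imfset//= Cg => /(_ isT)[] /=.
    by case: b.
  move=> i /imfsetP[j _ ->] /=; rewrite Cg.
  by split; [exact: (H (j, true)) | exact: (H (j, false))].
move=> ->.
- rewrite big_enum /= [RHS](eq_bigr (fun jb =>
    P (part (jb.1, jb.2) @^-1` B (jb.1, jb.2)))); last by case.
  rewrite -(pair_bigA _ (fun j b => P (part (j, b) @^-1` B (j, b)))) /=.
  apply: eq_bigr => j _; rewrite big_bool /= Cg.
  have [_ _ indep] := iid.2 _ (gD j).
  by apply: indep.
- by move=> i /= /imfsetP[j _ ->].
- move=> i _; rewrite /C; case: pickP => [j _|_]; last exact: measurableT.
  by apply: measurableX; exact: mB.
Qed.

Let Re_comb_tail (c : J -> R[i]) (a : R) :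
  \sum_j normc (c j) ^+ 2 <= 1 -> 0 < a ->
  measurable [set w | a <= complex.Re (\sum_j c j * zeta (g j) w)] /\
  (P [set w | (a <= complex.Re (\sum_j c j * zeta (g j) w)%R)%R] <=
    (expR (- (a ^+ 2 / 2)))%:E)%E.
Proof.
move=> c1 a0.
(* The coefficients of Re (c z) = Re c Re z - Im c Im z; the sum of their squares is that of the
   squared moduli of [c]. *)
pose b (jb : J * bool) := if jb.2 then complex.Re (c jb.1) else - complex.Im (c jb.1).
have sumE w : complex.Re (\sum_j c j * zeta (g j) w) = \sum_jb b jb * part jb w.
  rewrite Re_sum [RHS](eq_bigr (fun jb =>
    b (jb.1, jb.2) * part (jb.1, jb.2) w)); last by case.
  rewrite -(pair_bigA _ (fun j k => b (j, k) * part (j, k) w)) /=.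
  apply: eq_bigr => j _; rewrite big_bool /b /part /= mulNr.
  by case: (c j) (zeta (g j) w) => [? ?] [? ?].
have -> : [set w | a <= complex.Re (\sum_j c j * zeta (g j) w)] =
    [set w | a <= \sum_jb b jb * part jb w].
  by apply/seteqP; split => w /=; rewrite sumE.
split.
  have mY : measurable_fun [set: T] (fun w => \sum_jb b jb * part jb w).
    apply: measurable_sum => jb; apply: measurable_funM => //.
    by case: (part_gaussian jb).
  rewrite -[X in measurable X]setTI.
  have := mY measurableT _ (measurable_itv `[a, +oo[).
  by congr measurable; apply/seteqP; split => w /=; rewrite in_itv /= andbT.
apply: gaussian_sum_tail => //.
apply: le_trans c1.
rewrite (eq_bigr (fun jb => b (jb.1, jb.2) ^+ 2)); last by case.
rewrite -(pair_bigA _ (fun j k => b (j, k) ^+ 2)) /=.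
by apply: ler_sum => j _; rewrite big_bool /b /= sqrrN sqr_normcE.
Qed.

(* The four half-planes [Re (u * Z) >= a] with [u^4 = 1] cover the
   complement of the square of half-side [a]. *)
Lemma complex_gaussian_sum_tail (c : J -> R[i]) (a : R) :
  \sum_j normc (c j) ^+ 2 <= 1 -> 0 < a ->
  exists A : set T, [/\ measurable A,
    (P A <= (4 * expR (- (a ^+ 2 / 2)))%:E)%E &
    forall w, ~ A w -> normc (\sum_j c j * zeta (g j) w) <= 2 * a].
Proof.
move=> c1 a0.
pose A (k : 'I_4) :=
  [set w | a <= complex.Re (\sum_j ('i%C ^+ k * c j) * zeta (g j) w)].
have normi k : normc ('i%C ^+ k : R[i]) = 1.
  elim: k => [|k IH]; first by rewrite expr0 normc1.
  by rewrite exprS normcM IH mulr1 /= expr0n /= add0r expr1n sqrtr1.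
have tail k : measurable (A k) /\ (P (A k) <= (expR (- (a ^+ 2 / 2)))%:E)%E.
  apply: Re_comb_tail => //; under eq_bigr do rewrite normcM normi mul1r.
  exact: c1.
exists (\big[setU/set0]_(k < 4) A k); split.
- by apply: bigsetU_measurable => k _; case: (tail k).
- apply: le_trans (le_measure_bigsetU _ _) _; first by move=> k; case: (tail k).
  apply: (@le_trans _ _ (\sum_(k < 4) (expR (- (a ^+ 2 / 2)))%:E)%E).
    by apply: lee_sum => k _; case: (tail k).
  by rewrite sumEFin sumr_const card_ord mulr_natl.
move=> w nA; set z := \sum_j c j * zeta (g j) w.
have Re_lt (k : 'I_4) : complex.Re ('i%C ^+ k * z) < a.
  rewrite ltNge; apply/negP => ak; apply: nA.
  rewrite (bigD1 k)//=; left; rewrite /A /=.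
  rewrite (eq_bigr (fun j => 'i%C ^+ k * (c j * zeta (g j) w))).
    by rewrite -mulr_sumr.
  by move=> j _; rewrite mulrA.
have := Re_lt (inord 0); have := Re_lt (inord 1); have := Re_lt (inord 2).
have := Re_lt (inord 3); rewrite !inordK// expr0 expr1 mul1r.
rewrite (exprS _ 2) sqr_i mulrN1 !mulNr mul1r.
have -> : complex.Re (- z) = - complex.Re z by case: (z).
have -> : complex.Re (- ('i%C * z)) = complex.Im z by case: (z) => u v; simpc.
have -> : complex.Re ('i%C * z) = - complex.Im z by case: (z) => u v; simpc.
(* The four inequalities bound both |Re z| and |Im z| by [a], whence the factor 2. *)
move=> h1 h2 h3 h4; apply: le_trans (le_normc_ReIm z) _.
by rewrite mulr2n mulrDl !mul1r lerD// ler_norml; apply/andP; split; lra.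
Qed.

End ComplexGaussianTail.
(** * Discrete Fourier transform *)

Section RootsOfUnity.
Context (R : realType).
Implicit Types a b : R.

Lemma cis0 : cis 0 = 1 :> R[i].
Proof. by rewrite /cis cos0 sin0. Qed.

Lemma cisD a b : cis (a + b) = cis a * cis b.
Proof. by rewrite /cis cosD sinD; simpc; congr (_ +i* _); exact: addrC. Qed.

Lemma cisX a m : cis (a * m%:R) = cis a ^+ m.
Proof.
elim: m => [|m IH]; first by rewrite mulr0 cis0.
by rewrite exprS -IH -cisD -nat1r mulrDr mulr1.
Qed.

Lemma normc_cis a : normc (cis a) = 1.
Proof. by rewrite /= cos2Dsin2 sqrtr1. Qed.

(** Here cos a = 1 - 2 sin^2 (a / 2), and a / 2 lies strictly between 0 and pi, where the sine is
    positive. *)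
Lemma cis_neq1 a : 0 < a < 2 * pi -> cis a != 1.
Proof.
move=> /andP[a0 a2]; apply/negP => /eqP[c1 _].
have s0 : 0 < sin (a / 2).
  by apply: sin_gt0_pi; rewrite divr_gt0//= ltr_pdivrMr// mulrC.
have : 0 < sin (a / 2) ^+ 2 by rewrite exprn_gt0.
move: c1; rewrite {1}(_ : a = a / 2 *+ 2); last by rewrite -mulr_natl; field.
by rewrite cos_mulr2n cos2sin2; lra.
Qed.

Lemma cis_primitive_root n : n.+1.-primitive_root (cis (2 * pi / n.+1%:R) : R[i]).
Proof.
apply/andP; split=> //; apply/forallP => i; rewrite unity_rootE -cisX.
have n0 : (n.+1%:R : R) != 0 by rewrite pnatr_eq0.
apply/eqP; have [ei|ni] := eqVneq (i.+1 : nat) n.+1.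
  rewrite ei divfK// (_ : 2 * pi = pi *+ 2); last by rewrite mulr_natl.
  by apply/eqP; rewrite /cis cos2pi sin2pi.
apply: negbTE; apply: cis_neq1.
rewrite mulr_gt0 ?divr_gt0 ?mulr_gt0 ?pi_gt0 ?ltr0n//= mulrAC ltr_pdivrMr ?ltr0n//.
by rewrite ltr_pM2l ?mulr_gt0 ?pi_gt0// ltr_nat ltn_neqAle ni ltn_ord.
Qed.

End RootsOfUnity.

Section DiscreteFourier.
Context (R : realType) (n : nat).
Implicit Types (x y phi : signal R).

Local Notation sqN := (Num.sqrt n.+1%:R : R).
Local Notation root := (cis (2 * pi / n.+1%:R) : R[i]).

Lemma sqrt_natS_gt0 : 0 < sqN. Proof. by rewrite sqrtr_gt0 ltr0n. Qed.

Lemma sqr_sqrt_natS : sqN * sqN = n.+1%:R.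
Proof. by rewrite -expr2 sqr_sqrtr. Qed.

Lemma dft_signalE x (k : 'I_n.+1) :
  dft_signal n x k 0 = sqN^-1%:C * \sum_(t < n.+1) x t%:Z * root ^+ (k * t).
Proof.
rewrite /dft_signal /dft mxE; congr (_ * _); apply: eq_bigr => t _.
by rewrite mxE -cisX natrM; congr (_ * cis _); ring.
Qed.

Lemma dft_signalB x y k : dft_signal n (x \- y) k 0 =
  dft_signal n x k 0 - dft_signal n y k 0.
Proof.
rewrite !dft_signalE -mulrBr -sumrB; congr (_ * _).
by apply: eq_bigr => t _; rewrite -mulrBl.
Qed.

Lemma dft_signalD x y k : dft_signal n (x \+ y) k 0 =
  dft_signal n x k 0 + dft_signal n y k 0.
Proof.
rewrite !dft_signalE -mulrDr -big_split /=; congr (_ * _).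
by apply: eq_bigr => t _; rewrite -mulrDl.
Qed.

Lemma dft_signalZ (c : R[i]) x k :
  dft_signal n (fun t => c * x t) k 0 = c * dft_signal n x k 0.
Proof.
rewrite !dft_signalE mulrCA; congr (_ * _); rewrite mulr_sumr.
by apply: eq_bigr => t _; rewrite mulrA.
Qed.

Lemma eq_dft_signal x y k : (forall t, (t < n.+1)%N -> x t%:Z = y t%:Z) ->
  dft_signal n x k 0 = dft_signal n y k 0.
Proof.
by move=> xy; rewrite !dft_signalE; congr (_ * _); apply: eq_bigr => t _; rewrite xy.
Qed.

Lemma normc_sqrt_natSV : normc (sqN^-1%:C : R[i]) = sqN^-1.
Proof. by rewrite normc_real ger0_norm// invr_ge0 ltW// sqrt_natS_gt0. Qed.

Lemma normc_root_exp m : normc (root ^+ m) = 1.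
Proof. by rewrite -cisX normc_cis. Qed.

Lemma root_neq0 : root != 0.
Proof. by rewrite (prim_root_eq0 (@cis_primitive_root R n)). Qed.

Lemma normc_dft_signal_le x (B : R) k :
  (forall t, (t < n.+1)%N -> normc (x t%:Z) <= B) ->
  normc (dft_signal n x k 0) <= sqN * B.
Proof.
move=> xB; rewrite dft_signalE normcM normc_sqrt_natSV.
rewrite ler_pdivrMl ?sqrt_natS_gt0// mulrA sqr_sqrt_natS.
apply: le_trans (le_normc_sum _ _ _) _.
apply: (@le_trans _ _ (\sum_(t < n.+1) B)).
  by apply: ler_sum => t _; rewrite normcM normc_root_exp mulr1 xB.
by rewrite sumr_const card_ord mulr_natl.
Qed.

(** Orthogonality of characters: off the diagonal this is a full geometric series whose ratio [u] is
    a nontrivial root of unity of order dividing n + 1. *)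
Lemma sum_root_expM (s t : 'I_n.+1) :
  \sum_(k < n.+1) root ^+ (k * s) * root ^- (k * t) = (s == t)%:R * n.+1%:R :> R[i].
Proof.
have prim := @cis_primitive_root R n; have r0 := root_neq0.
set u := root ^+ s / root ^+ t.
have uE k : root ^+ (k * s) * root ^- (k * t) = u ^+ k.
  by rewrite /u expr_div_n -!exprM mulnC [(k * t)%N]mulnC.
under eq_bigr do rewrite uE.
have [st|st] := eqVneq s t.
  rewrite /u st divff ?expf_neq0// mul1r.
  by under eq_bigr do rewrite expr1n; rewrite sumr_const card_ord.
rewrite mul0r; have u1 : 1 - u != 0.
  rewrite subr_eq0 eq_sym; apply: contra st => /eqP/divr1_eq/eqP.
  by rewrite (eq_prim_root_expr prim) !modn_small.
apply: (mulfI u1); rewrite mulr0 -[1 - u]opprB mulNr -subrX1 opprB.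
rewrite /u expr_div_n -!exprM ![(_ * n.+1)%N]mulnC !exprM.
by rewrite (prim_expr_order prim) !expr1n divr1 subrr.
Qed.

Lemma dft_signal_inv x (t : 'I_n.+1) :
  x t%:Z = sqN^-1%:C * \sum_(k < n.+1) dft_signal n x k 0 * root ^- (k * t).
Proof.
under eq_bigr => k _ do rewrite dft_signalE -mulrA mulr_suml.
rewrite -mulr_sumr exchange_big /=.
under eq_bigr => s _.
  under eq_bigr => k _ do rewrite -mulrA.
  rewrite -mulr_sumr sum_root_expM; over.
rewrite (bigD1 t)//= eqxx mul1r big1 ?addr0; last first.
  by move=> s st; rewrite (negbTE st) mul0r mulr0.
have -> : (n.+1%:R : R[i]) = sqN%:C * sqN%:C.
  by rewrite -rmorphM sqr_sqrt_natS rmorph_nat.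
have c0 : (sqN%:C : R[i]) != 0 by rewrite fmorph_eq0 gt_eqF// sqrt_natS_gt0.
by rewrite fmorphV /=; field.
Qed.

(** Inversion bounds each of the n + 1 entries by the l1-norm of the DFT over [sqN], and (n + 1) /
    [sqN] = [sqN]. *)
Lemma sum_normc_le_l1 x :
  \sum_(t < n.+1) normc (x t%:Z) <= sqN * norm_l1 (dft_signal n x).
Proof.
apply: (@le_trans _ _ (\sum_(t < n.+1) sqN^-1 * norm_l1 (dft_signal n x))).
  apply: ler_sum => t _; rewrite dft_signal_inv normcM normc_sqrt_natSV.
  apply: ler_wpM2l; first by rewrite invr_ge0 ltW// sqrt_natS_gt0.
  apply: le_trans (le_normc_sum _ _ _) _; apply: ler_sum => k _.
  by rewrite normcM normcV normc_root_exp invr1 mulr1.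
have c0 : sqN != 0 by rewrite gt_eqF// sqrt_natS_gt0.
rewrite sumr_const card_ord -(mulr_natl (_ * _)) mulrA (_ : n.+1%:R / sqN = sqN)//.
by apply: (mulIf c0); rewrite divfK// sqr_sqrt_natS.
Qed.

(* Up to phases the correlation of [phi] with the reversed [z] is a sum of
   products of Fourier coefficients. *)
Lemma normc_conv_last_le phi z (B : R) :
  (forall k, normc (dft_signal n z k 0) <= B) ->
  normc (\sum_(t < n.+1) phi t%:Z * z (n%:Z - t%:Z)) <=
  norm_l1 (dft_signal n phi) * B.
Proof.
move=> zB; have r0 := root_neq0.
have -> : \sum_(t < n.+1) phi t%:Z * z (n%:Z - t%:Z) =
    \sum_(k < n.+1) dft_signal n phi k 0 * (root ^- (k * n) * dft_signal n z k 0).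
  under eq_bigr => t _ do rewrite dft_signal_inv mulrAC mulr_sumr.
  rewrite exchange_big /=; apply: eq_bigr => k _.
  set F := dft_signal n phi k 0.
  rewrite dft_signalE !mulr_sumr [RHS](reindex_inj rev_ord_inj) /=.
  apply: eq_bigr => t _; have tn : (t <= n)%N by rewrite -ltnS.
  rewrite subSS subzn//.
  have -> : root ^- (k * n) = root ^- (k * t) * root ^- (k * (n - t)).
    by rewrite -invfM -exprD -mulnDr subnKC.
  have := expf_neq0 (k * (n - t)) r0; have := expf_neq0 (k * t) r0.
  by move: (root ^+ _) (root ^+ _) (sqN^-1%:C) => u v c u0 v0; field; rewrite u0 v0.
apply: le_trans (le_normc_sum _ _ _) _; rewrite /norm_l1 mulr_suml.
apply: ler_sum => k _; rewrite !normcM normcV normc_root_exp invr1 mul1r.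
by rewrite ler_wpM2l// normc_ge0.
Qed.

Lemma norm_looP (v : 'cV[R[i]]_n.+1) (B : R) : 0 <= B ->
  norm_loo v <= B <-> forall k, normc (v k 0) <= B.
Proof.
move=> B0; rewrite /norm_loo; split => [vB k|vB].
  by apply: le_trans vB; exact: le_bigmax_cond.
by apply: bigmax_le => // k _; exact: vB.
Qed.

Lemma convolutionE phi y t : supported n phi ->
  convolution phi y t = \sum_(k < n.+1) phi k%:Z * y (t - k%:Z).
Proof.
move=> sphi; rewrite /convolution.
rewrite -(fsbig_widen [set` [seq k%:Z | k <- iota 0 n.+1]])//; last first.
  move=> i [_ /= ni]; rewrite sphi ?mul0r//; apply: contra_notN ni => /andP[i0 iN].
  rewrite -[_ :: _]/(map Posz (iota 0 n.+1)).
  apply/mapP; exists `|i|%N; first by rewrite mem_iota /= add0n ltnS -lez_nat gez0_abs.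
  by rewrite gez0_abs.
rewrite -fsbig_seq; last by rewrite map_inj_uniq ?iota_uniq// => i j [].
by rewrite big_map -[iota _ _]/(index_iota 0 n.+1) big_mkord.
Qed.

End DiscreteFourier.

(** * Error decomposition through the oracle filter *)

Section DeterministicBounds.
Context (R : realType) (n : nat).
Implicit Types (x y z phi : signal R).

Local Notation sqN := (Num.sqrt n.+1%:R : R).

(** For 0 <= s <= n its restriction to [0, n] is the window of [z] on [-s, n - s]; these are the
    windows whose DFTs are controlled for the noise. *)
Definition shift_signal (s : int) z : signal R := fun t => z (t - s).

(** The value at [t] is the value at n for the signal shifted by n - t, so that the bound at the
    last point applies. *)
Lemma normc_convolution_le phi z (M : R) (t : nat) : supported n phi ->
  (t < n.+1)%N ->
  (forall (s : 'I_n.+1) k, normc (dft_signal n (shift_signal s%:Z z) k 0) <= M) ->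
  normc (convolution phi z t%:Z) <= norm_l1 (dft_signal n phi) * M.
Proof.
move=> sphi tn zM; rewrite (convolutionE _ _ sphi).
have sN : (n - t < n.+1)%N by rewrite ltnS leq_subr.
under eq_bigr => k _.
  rewrite (_ : z _ = shift_signal (Ordinal sN)%:Z z (n%:Z - k%:Z)); first over.
  rewrite /shift_signal /= -subzn//; congr z; ring.
by apply: normc_conv_last_le => k; exact: zM.
Qed.

(** The DFT of the convolution is the combination of the windowed DFTs with coefficients [phi],
    whose l1-norm in time is at most [sqN] times the one in frequency. *)
Lemma normc_dft_convolution_le phi z (M : R) k : supported n phi ->
  (forall (s : 'I_n.+1), normc (dft_signal n (shift_signal s%:Z z) k 0) <= M) ->
  normc (dft_signal n (convolution phi z) k 0) <=
  sqN * norm_l1 (dft_signal n phi) * M.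
Proof.
move=> sphi zM; have M0 : 0 <= M := le_trans (normc_ge0 _) (zM ord0).
have -> : dft_signal n (convolution phi z) k 0 =
    \sum_(s < n.+1) phi s%:Z * dft_signal n (shift_signal s%:Z z) k 0.
  rewrite dft_signalE mulr_sumr.
  under eq_bigr => t _ do rewrite (convolutionE _ _ sphi) mulr_suml mulr_sumr.
  rewrite exchange_big /=; apply: eq_bigr => s _.
  rewrite dft_signalE !mulr_sumr; apply: eq_bigr => t _.
  by rewrite /shift_signal; ring.
apply: le_trans (le_normc_sum _ _ _) _.
apply: (@le_trans _ _ (\sum_(s < n.+1) normc (phi s%:Z) * M)).
  by apply: ler_sum => s _; rewrite normcM ler_wpM2l// normc_ge0.
by rewrite -mulr_suml ler_wpM2r// sum_normc_le_l1.
Qed.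

Lemma residual_ge0 y phi : 0 <= residual n y phi.
Proof. exact: bigmax_ge_id. Qed.

Lemma norm_l1_ge0 (v : 'cV[R[i]]_n.+1) : 0 <= norm_l1 v.
Proof. by apply: sumr_ge0 => k _; exact: normc_ge0. Qed.

Lemma convolutionC phi psi x : supported n phi -> supported n psi ->
  convolution phi (convolution psi x) =1 convolution psi (convolution phi x).
Proof.
move=> sphi spsi t; rewrite (convolutionE _ _ sphi) (convolutionE _ _ spsi).
under eq_bigr => k _ do rewrite (convolutionE _ _ spsi) mulr_sumr.
under [RHS]eq_bigr => k _ do rewrite (convolutionE _ _ sphi) mulr_sumr.
rewrite exchange_big /=; apply: eq_bigr => j _; apply: eq_bigr => k _.
by rewrite mulrCA; congr (_ * (_ * x _)); ring.
Qed.

Lemma convolutionB phi x y t : supported n phi ->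
  convolution phi (x \- y) t = convolution phi x t - convolution phi y t.
Proof.
move=> sphi; rewrite !(convolutionE _ _ sphi) -sumrB.
by apply: eq_bigr => k _; rewrite -mulrBr.
Qed.

Lemma convolution_observation phi x z (c : R[i]) t : supported n phi ->
  convolution phi (fun tau => x tau + c * z tau) t =
  convolution phi x t + c * convolution phi z t.
Proof.
move=> sphi; rewrite !(convolutionE _ _ sphi) mulr_sumr -big_split /=.
by apply: eq_bigr => k _; ring.
Qed.

Section Oracle.
Variables (x z phio phit : signal R) (sigma a b M : R).
Hypotheses (sigma0 : 0 <= sigma) (a0 : 0 <= a) (M0 : 0 <= M).
Let y : signal R := fun tau => x tau + sigma%:C * z tau.
Hypotheses (so : supported n phio) (st : supported n phit).
Hypothesis zM : forall (s : 'I_n.+1) k,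
  normc (dft_signal n (shift_signal s%:Z z) k 0) <= M.
Hypothesis xa : forall t, (t < n.+1)%N ->
  normc (x t%:Z - convolution phio y t%:Z) <= a.
Hypothesis o1 : norm_l1 (dft_signal n phio) <= b.

Let normcs : normc (sigma%:C : R[i]) = sigma.
Proof. by rewrite normc_real ger0_norm. Qed.

Let zM0 k : normc (dft_signal n z k 0) <= M.
Proof.
have := zM ord0 k; rewrite (@eq_dft_signal _ _ _ z)// => t _.
by rewrite /shift_signal subr0.
Qed.

(** The residual signal is the oracle error plus the noise; a pointwise bound loses a factor [sqN]
    under the DFT. *)
Lemma residual_oracle_le : residual n y phio <= sqN * a + sigma * M.
Proof.
apply/norm_looP; first by rewrite addr_ge0 ?mulr_ge0// ltW// sqrt_natS_gt0.
move=> k.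
have -> : dft_signal n (y \- convolution phio y) k 0 =
    dft_signal n (x \- convolution phio y) k 0 + sigma%:C * dft_signal n z k 0.
  rewrite -dft_signalZ -dft_signalD; apply: eq_dft_signal => t _ /=.
  by rewrite {1}/y; ring.
apply: le_trans (le_normcD _ _) _; apply: lerD.
  exact: normc_dft_signal_le.
by rewrite normcM normcs ler_wpM2l.
Qed.

(** The three summands come from (1 - ft) * (x - fo * x), from fo * (x - ft * x), and from the noise
    filtered by ft. *)
Lemma recovery_error_le (A r' : R) :
  norm_l1 (dft_signal n phit) <= A -> residual n y phit <= r' ->
  normc (x n%:Z - convolution phit y n%:Z) <=
  (1 + sqN * A) * (a + sigma * (b * M)) +
  b * (r' + sigma * M + sigma * (sqN * A * M)) + sigma * (A * M).
Proof.
move=> tA tr.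
have A0 : 0 <= A := le_trans (norm_l1_ge0 _) tA.
have N0 : 0 <= sqN by rewrite ltW// sqrt_natS_gt0.
(* Replacing [y] by [x] in the oracle error costs only the noise filtered by the oracle. *)
have bias t : (t < n.+1)%N ->
    normc ((x \- convolution phio x) t%:Z) <= a + sigma * (b * M).
  move=> tn; rewrite (_ : _ t%:Z = (x t%:Z - convolution phio y t%:Z) +
      sigma%:C * convolution phio z t%:Z); last first.
    by rewrite /= convolution_observation//; ring.
  apply: le_trans (le_normcD _ _) _; apply: lerD; first exact: xa.
  rewrite normcM normcs ler_wpM2l//.
  by apply: le_trans (normc_convolution_le so tn zM) _; rewrite ler_wpM2r.
(* In turn: the residual of the solution, the raw noise, and the noise filtered by the solution. *)
have spec k : normc (dft_signal n (x \- convolution phit x) k 0) <=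
    r' + sigma * M + sigma * (sqN * A * M).
  have -> : dft_signal n (x \- convolution phit x) k 0 =
      dft_signal n (y \- convolution phit y) k 0 - sigma%:C * dft_signal n z k 0
      + sigma%:C * dft_signal n (convolution phit z) k 0.
    rewrite -!dft_signalZ -dft_signalB -dft_signalD; apply: eq_dft_signal => t _ /=.
    by rewrite convolution_observation// /y; ring.
  apply: le_trans (le_normcD _ _) _; apply: lerD.
    apply: le_trans (le_normcD _ _) _; apply: lerD.
      have r0 := le_trans (residual_ge0 y phit) tr.
      by move: tr => /norm_looP -/(_ r0).
    by rewrite normcN normcM normcs ler_wpM2l.
  rewrite normcM normcs ler_wpM2l//.
  apply: le_trans (normc_dft_convolution_le st (fun s => zM s k)) _.
  by rewrite ler_wpM2r// ler_wpM2l.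
have -> : x n%:Z - convolution phit y n%:Z =
    (x \- convolution phio x) n%:Z - convolution phit (x \- convolution phio x) n%:Z
    + convolution phio (x \- convolution phit x) n%:Z
    - sigma%:C * convolution phit z n%:Z.
  rewrite !convolutionB// (convolutionC _ so st) convolution_observation//=.
  by ring.
apply: le_trans (le_normcD _ _) _; apply: lerD; last first.
  rewrite normcN normcM normcs ler_wpM2l//.
  by apply: le_trans (normc_convolution_le st _ zM) _; rewrite ?ler_wpM2r.
apply: le_trans (le_normcD _ _) _; apply: lerD; last first.
  rewrite (convolutionE _ _ so); apply: le_trans (normc_conv_last_le _ spec) _.
  by rewrite ler_wpM2r//; exact: le_trans (normc_ge0 _) (spec ord0).
rewrite mulrDl mul1r; apply: le_trans (le_normcD _ _) _.
apply: lerD; first exact: bias.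
have B0 : 0 <= a + sigma * (b * M) := le_trans (normc_ge0 _) (bias 0 isT).
rewrite normcN (convolutionE _ _ st); apply: le_trans (le_normc_sum _ _ _) _.
apply: (@le_trans _ _ (\sum_(k < n.+1) normc (phit k%:Z) * (a + sigma * (b * M)))).
  apply: ler_sum => k _; rewrite normcM ler_wpM2l ?normc_ge0//.
  (* At time n the filter only reads times n - k in [0, n], where [bias] holds. *)
  have kn : (k <= n)%N by rewrite -ltnS.
  by rewrite subzn// bias// ltnS leq_subr.
rewrite -mulr_suml ler_wpM2r//; apply: le_trans (sum_normc_le_l1 _ _) _.
by rewrite ler_wpM2l.
Qed.

End Oracle.
End DeterministicBounds.

(** * Logarithmic factors *)

Section LogFactor.
Context (R : realType) (n : nat) (delta : R).
Hypothesis delta01 : 0 < delta < 1.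

Local Notation N := (n.+1%:R : R).
Local Notation rho := (N / delta).

Let d0 : 0 < delta. Proof. by case/andP: delta01. Qed.
Let N1 : 1 <= N. Proof. by rewrite ler1n. Qed.
Let N0 : 0 < N. Proof. by rewrite ltr0n. Qed.

Let rho1 : 1 <= rho.
Proof.
rewrite ler_pdivlMr// mul1r; case/andP: delta01 => _ /ltW h.
exact: le_trans h N1.
Qed.

Let rho0 : 0 < rho. Proof. exact: divr_gt0. Qed.

Lemma log_factor_ge0 : 0 <= ln rho. Proof. exact: ln_ge0. Qed.

Let sqr_rho : N * N / delta <= rho ^+ 2.
Proof.
rewrite (_ : rho ^+ 2 = N * N / delta * delta^-1); last by field; rewrite gt_eqF.
rewrite ler_peMr ?divr_ge0 ?mulr_ge0 ?ltW// invf_gt1//.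
by case/andP: delta01.
Qed.

Let rho2E : expR (2 * ln rho) = rho ^+ 2.
Proof. by rewrite mulr_natl mulr2n expRD lnK ?posrE. Qed.

(** N^2 entries, each failing on four half-planes at level a = 4 L, so that a^2 / 2 = 8 (1 + ln
    rho). In the exponential, exp 8 >= 8 pays for the constants and exp (8 ln rho) >= rho^2 >= N^2 /
    delta for the rest. *)
Lemma gaussian_union_bound :
  N * N * (4 * expR (- (8 * (1 + ln rho)))) <= delta / 2.
Proof.
have l0 := log_factor_ge0.
have h : 8 * (N * N / delta) <= expR (8 * (1 + ln rho)).
  rewrite mulrDr mulr1 expRD; apply: ler_pM => //.
  - by rewrite divr_ge0 ?mulr_ge0 ?ltW.
  - by apply: le_trans (expR_ge1Dx _); rewrite lerDr.
  - apply: le_trans sqr_rho _; rewrite -rho2E ler_expR; lra.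
rewrite expRN mulrA ler_pdivrMr ?expR_gt0//.
have -> : N * N * 4 = delta / 2 * (8 * (N * N / delta)) by field; rewrite gt_eqF.
by rewrite ler_wpM2l// divr_ge0// ltW.
Qed.

(** With delta' = delta / (2 N) the logarithm is that of 2 N^2 / delta <= e rho^2, so the radicand
    is at most 2 (1 + ln rho). The factor 5 / 3 is a rational above sqrt 2 that turns the oracle
    constant 3 into 5. *)
Lemma log_factor_oracle :
  Num.sqrt (1 + ln (N / (delta / (2 * N)))) <= 5 / 3 * Num.sqrt (1 + ln rho).
Proof.
have l0 := log_factor_ge0.
have c0 : (0 : R) <= 5 / 3 by lra.
rewrite -[5 / 3]ger0_norm// -sqrtr_sqr -sqrtrM ?sqr_ge0//; apply: ler_wsqrtr.
have : ln (N / (delta / (2 * N))) <= 1 + 2 * ln rho.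
  rewrite -[leRHS]expRK ler_ln ?posrE ?expR_gt0//; last first.
    by rewrite !divr_gt0// mulr_gt0.
  rewrite expRD rho2E (_ : N / (delta / (2 * N)) = 2 * (N * N / delta)); last first.
    by field; rewrite !gt_eqF.
  apply: ler_pM => //; first by rewrite divr_ge0 ?mulr_ge0 ?ltW.
  exact: expR_ge1Dx.
by nra.
Qed.

End LogFactor.

(** * Consequences of near-optimality *)

Lemma accurate_solution_le (R : realType) (X : Type) (feasible : set X)
    (objective : X -> R) (eps : R) (u v : X) :
  (forall w, 0 <= objective w) -> feasible v ->
  accurate_solution feasible objective eps u ->
  objective u <= objective v + eps.
Proof.
move=> obj0 fv [_ ule]; apply: le_trans ule _; rewrite lerD2r.
(* A real [inf] is a lower bound only for sets bounded below, here by 0. *)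
apply: ge_inf; last by exists v.
by exists 0 => _ [w _ <-].
Qed.

Section Solutions.
Context (R : realType) (n : nat) (C0 sigma r eps L lambda : R).
Variables (y phio phit : signal R).
Local Notation sqN := (Num.sqrt n.+1%:R : R).
Hypotheses (C0_gt0 : 0 < C0) (sigma0 : 0 < sigma) (r1 : 1 <= r) (L1 : 1 <= L).
Hypothesis (lambdaE : lambda = 16 * sigma * (sqN * L)).
Hypotheses (so : supported n phio).
Hypothesis o1 : norm_l1 (dft_signal n phio) <= r / sqN.
Hypothesis reso : residual n y phio <= 13 * sigma * r * L.
Hypothesis epsC : eps <= C0 * sigma * r.

Let epsL : eps <= C0 * sigma * r * L.
Proof.
apply: le_trans epsC _; rewrite ler_peMr// !mulr_ge0 ?ltW//.
exact: lt_le_trans r1.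
Qed.

Let sr0 : 0 <= sigma * r * L.
Proof. by rewrite !mulr_ge0 ?ltW//; [exact: lt_le_trans r1|exact: lt_le_trans L1]. Qed.

(** The constants are those of the penalized problem, so that both problems share one conclusion;
    here the proof yields 1 and 13 + C0. *)
Lemma con_uf_solution_bounds : con_uf_solution n r y eps phit ->
  [/\ supported n phit,
      norm_l1 (dft_signal n phit) <= (2 + C0) * (r / sqN) &
      residual n y phit <= (29 + C0) * sigma * r * L].
Proof.
move=> sol; have [[st t1] _] := sol; split=> //.
  apply: le_trans t1 _; rewrite ler_peMl//; last by move: C0_gt0; lra.
  by rewrite divr_ge0 ?sqrtr_ge0//; exact: le_trans r1.
have := accurate_solution_le (residual_ge0 n y) (conj so o1) sol.
move: reso epsL sr0; rewrite -!mulrA; move: (sigma * _) => ?; lra.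
Qed.

(** In units of sigma r L the oracle has objective at most 13 + 16 = 29, so both terms of the
    objective of the solution are at most 29 + C0. Division by [lambda] gives (29 + C0) / 16 <= 2 +
    C0 for the l1-norm. *)
Lemma pen_uf_solution_bounds : pen_uf_solution n lambda y eps phit ->
  [/\ supported n phit,
      norm_l1 (dft_signal n phit) <= (2 + C0) * (r / sqN) &
      residual n y phit <= (29 + C0) * sigma * r * L].
Proof.
move=> sol; have [st _] := sol.
have sq0 : 0 < sqN := sqrt_natS_gt0 R n.
have L0 : 0 < L by exact: lt_le_trans L1.
have lambda0 : 0 < lambda by rewrite lambdaE !mulr_gt0.
have obj0 w : 0 <= residual n y w + lambda * norm_l1 (dft_signal n w).
  by rewrite addr_ge0 ?residual_ge0// mulr_ge0 ?norm_l1_ge0// ltW.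
have := accurate_solution_le obj0 so sol.
have res0 := residual_ge0 n y phit.
have pen0 : 0 <= lambda * norm_l1 (dft_signal n phit).
  by rewrite mulr_ge0 ?norm_l1_ge0// ltW.
have peno : lambda * norm_l1 (dft_signal n phio) <= 16 * (sigma * r * L).
  apply: (@le_trans _ _ (lambda * (r / sqN))); first by rewrite ler_wpM2l// ltW.
  by rewrite lambdaE le_eqVlt; apply/orP; left; apply/eqP; field; rewrite gt_eqF.
move=> obj_le; split=> //; last first.
  move: obj_le reso epsL sr0; rewrite -!mulrA in peno *.
  move: (sigma * _) peno => ?; lra.
rewrite -(ler_pM2l lambda0).
have -> : lambda * ((2 + C0) * (r / sqN)) = 16 * (2 + C0) * (sigma * r * L).
  by rewrite lambdaE; field; rewrite gt_eqF.
have : 0 <= C0 * (sigma * r * L) by rewrite mulr_ge0// ltW.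
move: obj_le reso epsL sr0; rewrite -!mulrA in peno *.
move: (sigma * _) peno => q; lra.
Qed.

End Solutions.

(** * The good event *)

Section GoodEvent.
Context (R : realType) (n : nat) d (T : measurableType d) (P : probability T R).
Variable zeta : int -> T -> R[i].
Hypothesis iid : iid_standard_complex_gaussian P
  [set tau : int | - n%:Z <= tau <= n%:Z] zeta.

(** The entry combines the noise at times t - s, all in [-n, n], with n + 1 coefficients of modulus
    1 / sqrt (n + 1), whose squares sum to 1. *)
Lemma windowed_dft_tail (s k : 'I_n.+1) (a : R) : 0 < a ->
  exists A : set T, [/\ measurable A,
    (P A <= (4 * expR (- (a ^+ 2 / 2)))%:E)%E &
    forall w, ~ A w ->
      normc (dft_signal n (shift_signal s%:Z (fun tau => zeta tau w)) k 0) <= 2 * a].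
Proof.
move=> a0; pose g (t : 'I_n.+1) : int := t%:Z - s%:Z.
have g_inj : injective g by move=> t u /addIr [] /val_inj.
have gD t : [set tau : int | - n%:Z <= tau <= n%:Z] (g t).
  by rewrite /g /=; have := ltn_ord t; have := ltn_ord s; lia.
pose c (t : 'I_n.+1) : R[i] :=
  (Num.sqrt n.+1%:R)^-1%:C * cis (2 * pi / n.+1%:R) ^+ (k * t).
have c1 : \sum_t normc (c t) ^+ 2 <= 1.
  under eq_bigr do rewrite /c normcM normc_sqrt_natSV normc_root_exp mulr1
    exprVn sqr_sqrtr//.
  by rewrite sumr_const card_ord -(mulr_natl n.+1%:R^-1) divff// pnatr_eq0.
have [A [mA PA zA]] := complex_gaussian_sum_tail iid g_inj gD c1 a0.
exists A; split=> // w /zA; congr (normc _ <= _).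
rewrite dft_signalE mulr_sumr; apply: eq_bigr => t _.
by rewrite -[LHS]mulrA; congr (_ * _); exact: mulrC.
Qed.

Lemma le_measure_bigsetU_cst (I : finType) (A : I -> set T) (q : R) :
  (forall i, measurable (A i)) -> (forall i, (P (A i) <= q%:E)%E) ->
  (P (\big[setU/set0]_i A i) <= (#|I|%:R * q)%:E)%E.
Proof.
move=> mA Aq; apply: le_trans (le_measure_bigsetU _ mA) _.
apply: (@le_trans _ _ (\sum_(i : I) q%:E)%E); first by apply: lee_sum => i _; exact: Aq.
by rewrite sumEFin sumr_const mulr_natl.
Qed.

(** The events [good t] may fail to be measurable; the union bound runs over the complements of
    measurable subsets [B t]. *)
Lemma good_event (delta : R) (good : 'I_n.+1 -> set T) : 0 < delta < 1 ->
  (forall t, with_probability_at_least P (1 - delta / (2 * n.+1%:R)) (good t)) ->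
  with_probability_at_least P (1 - delta)
    [set w | (forall t, good t w) /\ forall s k : 'I_n.+1,
      normc (dft_signal n (shift_signal s%:Z (fun tau => zeta tau w)) k 0) <=
      8 * Num.sqrt (1 + ln (n.+1%:R / delta))].
Proof.
move=> d01 goodP; set L := Num.sqrt _.
have l0 := log_factor_ge0 n d01.
have L2 : L ^+ 2 = 1 + ln (n.+1%:R / delta) by rewrite sqr_sqrtr// addr_ge0.
(* The tail level a = 4 L: the modulus bound is 2 a = 8 L and the exponent a^2 / 2 = 8 L^2. *)
have L0 : 0 < 4 * L by rewrite mulr_gt0// sqrtr_gt0 ltr_pwDl.
have [A HA] := choice (fun p : 'I_n.+1 * 'I_n.+1 => windowed_dft_tail p.1 p.2 L0).
have [B HB] := choice goodP.
pose U := \big[setU/set0]_p A p; pose V := \big[setU/set0]_t ~` B t.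
have mA p : measurable (A p) by case: (HA p).
have mB t : measurable (~` B t) by apply: measurableC; case: (HB t).
have mU : measurable U by exact: bigsetU_measurable.
have mV : measurable V by exact: bigsetU_measurable.
have PU : (P U <= (delta / 2)%:E)%E.
  apply: le_trans (le_measure_bigsetU_cst mA _) _.
    by move=> p; case: (HA p) => _ PA _; exact: PA.
  rewrite lee_fin card_prod card_ord natrM.
  apply: le_trans (gaussian_union_bound n d01); rewrite le_eqVlt; apply/orP; left.
  by apply/eqP; rewrite -L2; congr (_ * (_ * expR _)); field.
have PV : (P V <= (delta / 2)%:E)%E.
  apply: le_trans (le_measure_bigsetU_cst (q := delta / (2 * n.+1%:R)) mB _) _.
    move=> t; have [mBt _ PB] := HB t; rewrite probability_setC//.
    have /fineK PBE : P (B t) \is a fin_num by exact: fin_num_measure.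
    by move: PB; rewrite -PBE -EFinB !lee_fin; move: (fine _) (delta / _) => u v; lra.
  rewrite lee_fin card_ord le_eqVlt; apply/orP; left; apply/eqP.
  have : (n.+1%:R : R) != 0 by rewrite pnatr_eq0.
  by move: n.+1%:R => q q0; field.
exists (~` (U `|` V)); split.
- by apply: measurableC; exact: measurableU.
- move=> w /= nUV; split=> [t|s k].
    have [_ sub _] := HB t; apply: sub; apply: contrapT => nB; apply: nUV; right.
    by rewrite /V (bigD1 t)//=; left.
  have [_ _ zA] := HA (s, k); rewrite (_ : 8 * L = 2 * (4 * L)); last by ring.
  apply: zA => Aw; apply: nUV; left.
  by rewrite /U (bigD1 (s, k))//=; left.
- rewrite probability_setC; last exact: measurableU.
  have : (P (U `|` V) <= delta%:E)%E.
    apply: le_trans (measureU2 _ _ _) _ => //.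
    by rewrite [in leRHS](splitr delta) EFinD; exact: leeD.
  move=> PUV; rewrite EFinB; exact: leeB.
Qed.

End GoodEvent.

(** * Constants and conclusion *)

Lemma recovery_constant_le (R : realType) (C0 sigma r L b sqN : R) :
  0 < C0 -> 0 <= sigma * b * L -> 1 <= r -> sqN * b = r ->
  (1 + sqN * ((2 + C0) * b)) * (5 * sigma * L * b + sigma * (b * (8 * L))) +
  b * ((29 + C0) * sigma * r * L + sigma * (8 * L) +
       sigma * (sqN * ((2 + C0) * b) * (8 * L))) +
  sigma * ((2 + C0) * b * (8 * L)) <=
  (108 + 30 * C0) * sigma * r * L * b.
Proof.
move=> C0_gt0 s0 r1 sb.
rewrite (_ : sqN * ((2 + C0) * b) = (2 + C0) * r); last by rewrite mulrCA sb.
(* In units of sigma b L the left side is (71 + 22 C0) r + (37 + 8 C0); r >= 1 absorbs the constant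
   part, and the sum of both coefficients is 108 + 30 C0. *)
rewrite -subr_ge0.
rewrite [leRHS](_ : _ = sigma * b * L * ((r - 1) * (21 + 8 * (2 + C0))));
  last by ring.
apply: mulr_ge0 => //; apply: mulr_ge0; first by rewrite subr_ge0.
by lra.
Qed.

Theorem theorem4p3 (R : realType) (C0 : R) (hC0 : 0 < C0) :
  exists2 C : R, 0 < C &
  forall (n : nat) (sigma delta r : R) (x : signal R)
    (d : measure_display) (T : measurableType d) (P : probability T R)
    (zeta : int -> T -> R[i]) (phio : signal R)
    (eps : R) (phit : T -> signal R),
  let y := observation sigma x zeta in
  let lambda :=
    16 * sigma * Num.sqrt (n.+1%:R * (1 + ln (n.+1%:R / delta))) in
  0 < sigma -> 0 < delta < 1 -> 1 <= r ->
  iid_standard_complex_gaussian P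
    [set tau : int | - n%:Z <= tau <= n%:Z] zeta ->
  supported n phio ->
  norm_l1 (dft_signal n phio) <= r / Num.sqrt n.+1%:R ->
  (forall (tau : int) (delta' : R),
     0 <= tau <= n%:Z -> 0 < delta' < 1 ->
     with_probability_at_least P (1 - delta')
       [set w | normc (x tau - convolution phio (y w) tau) <=
                3 * sigma * r * Num.sqrt (1 + ln (n.+1%:R / delta')) /
                Num.sqrt n.+1%:R]) ->
  eps <= C0 * sigma * r ->
  (forall w, con_uf_solution n r (y w) eps (phit w)) \/
  (forall w, pen_uf_solution n lambda (y w) eps (phit w)) ->
  with_probability_at_least P (1 - delta)
    [set w | normc (x n%:Z - convolution (phit w) (y w) n%:Z) <=
             C * sigma * r ^+ 2 * Num.sqrt (1 + ln (n.+1%:R / delta)) /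
             Num.sqrt n.+1%:R].
Proof.
exists (108 + 30 * C0); first by rewrite addr_gt0// mulr_gt0.
move=> n sigma delta r x d T P zeta phio eps phit y lambda.
move=> sigma0 d01 r1 iid so o1 oracle epsC sol.
pose sqN : R := Num.sqrt n.+1%:R; pose L := Num.sqrt (1 + ln (n.+1%:R / delta)).
have sq0 : 0 < sqN := sqrt_natS_gt0 R n.
have l0 := log_factor_ge0 n d01.
have L1 : 1 <= L by rewrite -[leLHS]sqrtr1 ler_wsqrtr// lerDl.
have L0 : 0 < L := lt_le_trans ltr01 L1.
have r0 : 0 < r := lt_le_trans ltr01 r1.
have lambdaE : lambda = 16 * sigma * (sqN * L) by rewrite /lambda sqrtrM.
have delta'01 : 0 < delta / (2 * n.+1%:R) < 1.
  case/andP: d01 => d0 d1; rewrite divr_gt0 ?mulr_gt0//= ltr_pdivrMr ?mulr_gt0// mul1r.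
  apply: lt_le_trans d1 _; have : (1 : R) <= n.+1%:R by rewrite ler1n.
  by lra.
pose a := 5 * sigma * L * (r / sqN).
have [E [mE EP PE]] := good_event iid d01 (fun t : 'I_n.+1 =>
  oracle t%:Z _ (ltn_ord t) delta'01).
(* From here on the outcome [w] is fixed and the argument is deterministic. *)
exists E; split=> // w /EP[good zM] /=.
have a0 : 0 <= a by rewrite !mulr_ge0 ?ltW// invr_gt0.
have M0 : 0 <= 8 * L by rewrite mulr_ge0// ltW.
have s0 := ltW sigma0.
have sqb : sqN * (r / sqN) = r by rewrite mulrC divfK// gt_eqF.
have xa t : (t < n.+1)%N ->
    normc (x t%:Z - convolution phio (y w) t%:Z) <= a.
  move=> tn; apply: le_trans (good (Ordinal tn)) _.
  rewrite (_ : a = 3 * sigma * r * (5 / 3 * L) / sqN); last first.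
    by rewrite /a; move: (gt_eqF sq0) => /negbT h; field.
  apply: ler_wpM2r; first by rewrite invr_ge0 ltW.
  apply: ler_wpM2l; first by rewrite !mulr_ge0// ltW.
  exact: log_factor_oracle.
(* The oracle error contributes [sqN] a = 5 sigma r L and the noise 8 sigma L <= 8 sigma r L. *)
have reso : residual n (y w) phio <= 13 * sigma * r * L.
  apply: le_trans (residual_oracle_le s0 a0 M0 zM xa) _.
  rewrite -/sqN /a (mulrCA sqN) sqb.
  have := mulr_ge0 (mulr_ge0 s0 (ltW L0)) (_ : 0 <= r - 1).
  by rewrite subr_ge0 => /(_ r1); nra.
have [st t1 rest] : [/\ supported n (phit w),
    norm_l1 (dft_signal n (phit w)) <= (2 + C0) * (r / sqN) &
    residual n (y w) (phit w) <= (29 + C0) * sigma * r * L].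
  case: sol => sol.
    exact: con_uf_solution_bounds hC0 sigma0 r1 L1 so o1 reso epsC (sol w).
  exact: pen_uf_solution_bounds hC0 sigma0 r1 L1 lambdaE so o1 reso epsC (sol w).
apply: le_trans (recovery_error_le s0 M0 so st zM xa o1 t1 rest) _.
(* One factor r of r^2 goes with 1 / [sqN] into b = r / [sqN]. *)
rewrite -/sqN [leRHS](_ : _ = (108 + 30 * C0) * sigma * r * L * (r / sqN)); last first.
  by rewrite -/L expr2; ring.
by apply: recovery_constant_le => //; rewrite !mulr_ge0 ?ltW// invr_gt0.
Qed.
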